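(* Let $X$, $Y$ be graphs, let $\varphi:X\to Y$ be a homomorphism which is both locally surjective and component equitable, and let $y\in V_Y$. Then $c(X)_y=\frac{k_X(y)}{k_C(y)}$ for all $C\in\mathcal{C}(X)_y$. In particular, $k_C(y)$ divides $k_X(y)$ for all $C\in\mathcal{C}(X)_y$.
   Context: All graphs are finite, undirected, simple and reflexive: a graph $X=(V_X,E_X)$ has a finite nonempty vertex set $V_X$, and $E_X$ consists of all loops $\{x\}$ ($x\in V_X$; written $\{x,x\}$) together with a (possibly empty) set of $2$-element subsets of $V_X$. A homomorphism $\varphi:X\to Y$ is a map $\varphi:V_X\to V_Y$ such that $\{x_1,x_2\}\in E_X$ implies $\{\varphi(x_1),\varphi(x_2)\}\in E_Y$. $N_X(x)=\{u\in V_X:\{x,u\}\in E_X\}$ (so $x\in N_X(x)$). $\varphi$ is locally surjective if $\varphi(N_X(x))=N_Y(\varphi(x))$ for all $x\in V_X$. $\mathcal{C}(X)$ is the set of components (maximal connected subgraphs) of $X$. For $y\in V_Y$ and a subgraph $\hat X$ of $X$, $k_{\hat X}(y)=|V_{\hat X}\cap\varphi^{-1}(y)|$ (so $k_X(y)=|\varphi^{-1}(y)|$); $\mathcal{C}(X)_y=\{C\in\mathcal{C}(X):k_C(y)>0\}$ and $c(X)_y=|\mathcal{C}(X)_y|$. $\varphi$ is component equitable if for every $y\in V_Y$ and all $C,\hat C\in\mathcal{C}(X)_y$ one has $k_C(y)=k_{\hat C}(y)$. *)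

(* Defs.v *)
From HB Require Import structures.
From mathcomp Require Import all_boot all_order all_algebra.

Set Implicit Arguments.
Unset Strict Implicit.
Unset Printing Implicit Defensive.

(* Edges are sets of vertices: the loop at [x] is the singleton [[set x]],
   which is also [[set x; x]], and every other edge has two elements. *)
Record graph := Graph {
  vertex :> finType;
  edges : {set {set vertex}};
  vertex_nonempty : 0 < #|vertex|;
  loop_in_edges : forall x, [set x] \in edges;
  edge_card : forall e, e \in edges -> 0 < #|e| <= 2
}.

Definition adj (X : graph) : rel X := fun x1 x2 => [set x1; x2] \in edges X.

Definition nbhd (X : graph) (x : X) : {set X} := [set u | adj x u].

Definition homomorphism (X Y : graph) (phi : X -> Y) : Prop :=
  forall x1 x2 : X, adj x1 x2 -> adj (phi x1) (phi x2).

Definition locally_surjective (X Y : graph) (phi : X -> Y) : Prop :=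
  forall x : X, phi @: nbhd x = nbhd (phi x).

(* A subgraph is again a graph, so it is nonempty and has all its loops. *)
Definition is_subgraph (X : graph) (H : {set X} * {set {set X}}) : bool :=
  [&& H.1 != set0, H.2 \subset edges X, [forall x in H.1, [set x] \in H.2]
    & [forall e in H.2, e \subset H.1]].

Record subgraph (X : graph) := Subgraph {
  subgraph_val : {set X} * {set {set X}};
  _ : is_subgraph subgraph_val
}.

HB.instance Definition _ (X : graph) := [isSub for @subgraph_val X].
HB.instance Definition _ (X : graph) := [Finite of subgraph X by <:].

Definition sub_vertices (X : graph) (H : subgraph X) : {set X} := (val H).1.
Definition sub_edges (X : graph) (H : subgraph X) : {set {set X}} := (val H).2.

Lemma whole_is_subgraph (X : graph) : is_subgraph ([set: X], edges X).
Proof.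
apply/and4P; split=> //=.
- by rewrite -card_gt0 cardsT vertex_nonempty.
- by apply/forall_inP=> x _; apply: loop_in_edges.
- by apply/forall_inP=> e _; apply: subsetT.
Qed.

Definition whole (X : graph) : subgraph X := Subgraph (whole_is_subgraph X).

Definition sub_le (X : graph) (H K : subgraph X) : bool :=
  (sub_vertices H \subset sub_vertices K) && (sub_edges H \subset sub_edges K).

Definition connected (X : graph) (H : subgraph X) : bool :=
  [forall x1 in sub_vertices H, forall x2 in sub_vertices H,
    connect [rel u v | [set u; v] \in sub_edges H] x1 x2].

Definition components (X : graph) : {set subgraph X} :=
  [set C | connected C &&
     [forall D : subgraph X, connected D && sub_le C D ==> (D == C)]].

Definition fiber_card (X Y : graph) (phi : X -> Y) (H : subgraph X) (y : Y) :
  nat := #|sub_vertices H :&: phi @^-1: [set y]|.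

Lemma fiber_card_whole (X Y : graph) (phi : X -> Y) (y : Y) :
  fiber_card phi (whole X) y = #|phi @^-1: [set y]|.
Proof. by rewrite /fiber_card /sub_vertices /= setTI. Qed.

Definition components_over (X Y : graph) (phi : X -> Y) (y : Y) :
  {set subgraph X} := [set C in components X | 0 < fiber_card phi C y].

Definition component_equitable (X Y : graph) (phi : X -> Y) : Prop :=
  forall (y : Y) (C C' : subgraph X),
    C \in components_over phi y -> C' \in components_over phi y ->
    fiber_card phi C y = fiber_card phi C' y.

(* Main.v *)
(** Every vertex lies in exactly one component: a largest connected subgraph
    through it exists, and two components sharing a vertex both equal their
    union. Counting the fiber over [y] component by component thus writes
    [k_X(y)] as a sum of [c(X)_y] terms, all equal by equitability. *)

Require Import Defs.
From mathcomp Require Import all_boot all_order all_algebra.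

Import GRing.Theory Num.Theory.

(** One vertex with its loop: the connected subgraph from which the search for a component through
    [x] starts. *)
Lemma single_is_subgraph (X : graph) (x : X) :
  is_subgraph ([set x], [set [set x]]).
Proof.
apply/and4P; split=> /=.
- by apply/set0Pn; exists x; rewrite set11.
- by rewrite sub1set loop_in_edges.
- by apply/forall_inP=> z /set1P ->; rewrite set11.
- by apply/forall_inP=> e /set1P ->.
Qed.

Definition single (X : graph) (x : X) : subgraph X :=
  Subgraph (single_is_subgraph X x).

Lemma connected_single (X : graph) (x : X) : connected (single X x).
Proof.
by apply/forall_inP=> u /set1P ->; apply/forall_inP=> v /set1P ->.
Qed.

Lemma union_is_subgraph (X : graph) (H K : subgraph X) :
  is_subgraph (sub_vertices H :|: sub_vertices K, sub_edges H :|: sub_edges K).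
Proof.
case/and4P: (valP H) => H0 HE /forall_inP Hl /forall_inP HV.
case/and4P: (valP K) => _ KE /forall_inP Kl /forall_inP KV.
apply/and4P; split=> /=.
- by case/set0Pn: H0 => x xH; apply/set0Pn; exists x; rewrite inE xH.
- by rewrite subUset HE.
- by apply/forall_inP=> x /setUP[/Hl|/Kl] xE; rewrite inE xE ?orbT.
- apply/forall_inP=> e /setUP[/HV|/KV] eV; apply: subset_trans eV _.
  + exact: subsetUl.
  + exact: subsetUr.
Qed.

Definition union (X : graph) (H K : subgraph X) : subgraph X :=
  Subgraph (union_is_subgraph X H K).

Lemma sub_le_unionl (X : graph) (H K : subgraph X) : sub_le H (union X H K).
Proof. by apply/andP; split; apply: subsetUl. Qed.

Lemma sub_le_unionr (X : graph) (H K : subgraph X) : sub_le K (union X H K).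
Proof. by apply/andP; split; apply: subsetUr. Qed.

Lemma connectedP (X : graph) (H : subgraph X) :
  reflect {in sub_vertices H &, forall u v,
             connect [rel u v | [set u; v] \in sub_edges H] u v}
          (connected H).
Proof.
apply: (iffP forall_inP) => [Hc u v uH vH | Hc u uH].
  by move/forall_inP: (Hc u uH); apply.
by apply/forall_inP=> v vH; apply: Hc.
Qed.

Lemma sub_le_connect (X : graph) (H K : subgraph X) (u v : X) :
  sub_le H K -> connect [rel u v | [set u; v] \in sub_edges H] u v ->
  connect [rel u v | [set u; v] \in sub_edges K] u v.
Proof.
case/andP=> _ /subsetP HK; apply: connect_sub => a b /= /HK abK.
exact: connect1.
Qed.

(** Any two vertices of the union are joined by a walk through the shared vertex [x]. *)
Lemma connected_union (X : graph) (H K : subgraph X) (x : X) :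
  x \in sub_vertices H -> x \in sub_vertices K ->
  connected H -> connected K -> connected (union X H K).
Proof.
move=> xH xK /connectedP Hc /connectedP Kc.
(* [connect] is directed, so [via] provides walks both to and from [x]; this avoids a symmetry
   argument. *)
have via u : u \in sub_vertices (union X H K) ->
    connect [rel u v | [set u; v] \in sub_edges (union X H K)] u x /\
    connect [rel u v | [set u; v] \in sub_edges (union X H K)] x u.
  case/setUP=> uV; split.
  - by apply: sub_le_connect (sub_le_unionl X H K) _; apply: Hc.
  - by apply: sub_le_connect (sub_le_unionl X H K) _; apply: Hc.
  - by apply: sub_le_connect (sub_le_unionr X H K) _; apply: Kc.
  - by apply: sub_le_connect (sub_le_unionr X H K) _; apply: Kc.
apply/connectedP=> u v /via[ux _] /via[_ xv].
exact: connect_trans ux xv.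
Qed.

Lemma componentsP (X : graph) (C : subgraph X) :
  reflect (connected C /\ forall D, connected D -> sub_le C D -> D = C)
          (C \in components X).
Proof.
rewrite inE; apply: (iffP andP) => -[Cc Cmax]; split=> //.
  move=> D Dc CD; apply/eqP; move/forallP/(_ D)/implyP: Cmax; apply.
  by rewrite Dc.
by apply/forallP=> D; apply/implyP=> /andP[Dc CD]; apply/eqP; apply: Cmax.
Qed.

Lemma component_exists (X : graph) (x : X) :
  exists2 C, C \in components X & x \in sub_vertices C.
Proof.
pose P (H : subgraph X) := connected H && (x \in sub_vertices H).
(* Edges are counted too: a component is maximal in both coordinates, and vertices alone would not
   detect a missing edge. *)
pose size (H : subgraph X) := #|sub_vertices H| + #|sub_edges H|.
have P1 : P (single X x) by rewrite /P connected_single /sub_vertices set11.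
case: (arg_maxnP size P1) => C /andP[Cc xC] Cmax.
exists C => //; apply/componentsP; split=> // D Dc /andP[CDv CDe].
have /Cmax le_DC : P D by rewrite /P Dc (subsetP CDv).
(* Neither cardinal drops from [C] to [D], while their sum does not grow; hence both agree, and the
   inclusions are equalities. *)
have leV := subset_leq_card CDv; have leE := subset_leq_card CDe.
apply: val_inj; apply/esym/eqP; rewrite [val C]surjective_pairing.
rewrite [val D]surjective_pairing xpair_eqE !eqEcard CDv CDe /=.
rewrite -/(sub_vertices C) -/(sub_vertices D) -/(sub_edges C) -/(sub_edges D).
apply/andP; split.
  by rewrite -(leq_add2r #|sub_edges D|) (leq_trans le_DC) // leq_add2l.
by rewrite -(leq_add2l #|sub_vertices D|) (leq_trans le_DC) // leq_add2r.
Qed.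

(** The union is connected and lies above both [C] and [D], so maximality of each identifies it with
    both. *)
Lemma component_unique (X : graph) (C D : subgraph X) (x : X) :
  C \in components X -> D \in components X ->
  x \in sub_vertices C -> x \in sub_vertices D -> C = D.
Proof.
move=> /componentsP[Cc Cmax] /componentsP[Dc Dmax] xC xD.
have Uc := connected_union X C D x xC xD Cc Dc.
by rewrite -(Cmax _ Uc (sub_le_unionl X C D)) {1}(Dmax _ Uc (sub_le_unionr X C D)).
Qed.

Lemma card_components_at (X : graph) (x : X) :
  #|[set C in components X | x \in sub_vertices C]| = 1.
Proof.
have [C Cc xC] := component_exists X x.
apply/eqP/cards1P; exists C; apply/setP=> D; rewrite in_set in_set1.
apply/andP/eqP => [[Dc xD] | ->]; last by split.
exact: component_unique Dc Cc xD xC.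
Qed.

(** Double counting of the pairs of a component and a vertex of the fiber lying in it: each vertex
    occurs in exactly one pair. *)
Lemma fiber_card_sum (X Y : graph) (phi : X -> Y) (y : Y) :
  fiber_card phi (whole X) y
    = \sum_(C in components_over phi y) fiber_card phi C y.
Proof.
rewrite fiber_card_whole.
(* Components that miss the fiber contribute zero, so the sum may range over all components, as
   [card_components_at] requires. *)
have -> : \sum_(C in components_over phi y) fiber_card phi C y
          = \sum_(C in components X) fiber_card phi C y.
  rewrite [RHS](bigID (fun C => 0 < fiber_card phi C y)) /=.
  rewrite [X in _ + X]big1 ?addn0 => [|C /andP[_]]; last first.
    by rewrite lt0n negbK => /eqP.
  by apply: eq_bigl => C; rewrite in_set.
rewrite -sum1_card; under [RHS]eq_bigr => C _ do
  rewrite /fiber_card -sum1_card.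
rewrite (exchange_big_dep (mem (phi @^-1: [set y]))) /=; last first.
  by move=> C x _ /setIP[].
apply: eq_bigr => x xy; rewrite -[LHS](card_components_at X x).
by rewrite -sum1_card; apply: eq_bigl => C; rewrite in_set in_setI xy andbT.
Qed.

Theorem proposition6p8 (X Y : graph) (phi : X -> Y)
    (phi_hom : homomorphism phi)
    (phi_surj : locally_surjective phi)
    (phi_equi : component_equitable phi)
    (y : Y) :
  (forall C : subgraph X, C \in components_over phi y ->
     (#|components_over phi y|%:R : rat)%R
       = ((fiber_card phi (whole X) y)%:R / (fiber_card phi C y)%:R)%R)
  /\
  (forall C : subgraph X, C \in components_over phi y ->
     fiber_card phi C y %| fiber_card phi (whole X) y).
Proof.
(* The product form over the naturals yields both the quotient and the divisibility. *)
have kE C : C \in components_over phi y ->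
    fiber_card phi (whole X) y
      = #|components_over phi y| * fiber_card phi C y.
  move=> Cy; rewrite fiber_card_sum -sum_nat_const.
  by apply: eq_bigr => D Dy; apply: phi_equi.
split=> C Cy; last by rewrite (kE C Cy) dvdn_mull.
(* Positivity makes the division in [rat] a genuine one. *)
have k_gt0 : 0 < fiber_card phi C y by move: Cy; rewrite inE => /andP[].
by rewrite (kE C Cy) natrM mulfK // pnatr_eq0 -lt0n.
Qed.
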